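(* Let $N\ge1$, $a\in\{1,\ldots,N\}$. For any integer $k\ge0$, the commutator of the $k$-th power of $\mathcal M^a_N$ with $X$ is $$ [(\mathcal M^a_N)^k,X]=\sum_{j=0}^{k-1}(\mathcal M^a_N)^j\;R_1\;(\mathcal M^a_N)^{k-1-j}, $$ where $R_1$ is the commutator of $\mathcal M^a_N$ with $X$, given by $$ R_1=[\mathcal M^a_N,X]=(q-1)\sum_{\substack{I\subset\{1,\dots,N\}\\ |I|=a}}C_I(x)\Big(\sum_{i\in I}x_i\Big)\Gamma_I . $$
   Context: Let $q,t$ be parameters and $x_1,\dots,x_N$ independent variables. All operators act on rational functions $\mathbb C(q,t)(x_1,\dots,x_N)$; rational functions act by multiplication. $\Gamma_i$ replaces $x_i$ by $q x_i$ and fixes the other variables, and $\Gamma_I=\prod_{i\in I}\Gamma_i$. The Macdonald operator here is $$ \mathcal M^a_N=\sum_{\substack{I\subset\{1,\ldots,N\}\\ |I|=a}}C_I(x)\,\Gamma_I,\qquad C_I(x)=\prod_{i\in I}\ \prod_{j\in\{1,\dots,N\}\setminus I}\frac{t x_i-x_j}{x_i-x_j}. $$ $X$ is the operator of multiplication by $\sum_{i=1}^N x_i$, and $[A,B]=AB-BA$. *)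

(* Defs.v *)
From HB Require Import structures.
From mathcomp Require Import all_boot all_order all_algebra.
From mathcomp Require Import generic_quotient complex reals.
From mathcomp Require Import mpoly.

Set Implicit Arguments.
Unset Strict Implicit.
Unset Printing Implicit Defensive.

Import GRing.Theory.

Local Open Scope ring_scope.
Local Open Scope quotient_scope.

Local Notation "x %:F" := (FracField.tofrac x).

(* C(q, t), where q and t are the two indeterminates *)
Definition Cqt (C : fieldType) : fieldType := {fraction {mpoly C[2]}}.
Definition qpar (C : fieldType) : Cqt C := ('X_ord0 : {mpoly C[2]})%:F.
Definition tpar (C : fieldType) : Cqt C := ('X_ord_max : {mpoly C[2]})%:F.

Lemma fraction_numden (D : idomainType) (f : {fraction D}) :
  f = (\n_(repr f))%:F / (\d_(repr f))%:F.
Proof.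
have d0 := denom_ratioP (repr f).
apply: (canRL (mulfK _)); first by rewrite tofrac_eq0.
rewrite -{1}[f]reprK; unlock FracField.tofrac.
rewrite -[LHS]FracField.pi_mul; apply/eqmodP.
rewrite /= FracField.equivfE /FracField.mulf.
by rewrite !numden_Ratio ?mulr1 ?oner_neq0 // mulrC.
Qed.

(* K(x_1, ..., x_N); the variables are indexed by 'I_N *)
Definition ratfun (K : fieldType) (N : nat) : fieldType :=
  {fraction {mpoly K[N]}}.

Section Operators.
Variables (K : fieldType) (N : nat).
Implicit Types (q t : K) (i : 'I_N) (I : {set 'I_N}) (f : ratfun K N).

Definition rcst (c : K) : ratfun K N := (c%:MP : {mpoly K[N]})%:F.
Definition rvar i : ratfun K N := ('X_i : {mpoly K[N]})%:F.

Definition qshift_mpoly q i (p : {mpoly K[N]}) : {mpoly K[N]} :=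
  p \mPo [tuple if j == i then q *: 'X_j else 'X_j | j < N].

(* For q != 0 the value does not depend on the representative of f, see
   Gamma_div. *)
Definition Gamma q i f : ratfun K N :=
  (qshift_mpoly q i \n_(repr f))%:F / (qshift_mpoly q i \d_(repr f))%:F.

Definition Gamma_set q I : ratfun K N -> ratfun K N :=
  \big[(fun A B : ratfun K N -> ratfun K N => A \o B)/id]_(i in I) Gamma q i.

Definition macdonald_coef t I : ratfun K N :=
  \prod_(i in I) \prod_(j in ~: I)
    ((rcst t * rvar i - rvar j) / (rvar i - rvar j)).

Definition macdonald q t (a : nat) f : ratfun K N :=
  \sum_(I : {set 'I_N} | #|I| == a) macdonald_coef t I * Gamma_set q I f.

Definition Xop f : ratfun K N := (\sum_(i < N) rvar i) * f.

Definition commutator (A B : ratfun K N -> ratfun K N) f : ratfun K N :=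
  A (B f) - B (A f).

Lemma qshift_mpoly_inj q i : q != 0 -> injective (qshift_mpoly q i).
Proof.
move=> q0; apply: (can_inj (g := qshift_mpoly q^-1 i)) => p.
rewrite /qshift_mpoly; elim/mpolyind: p => [|c m p _ _ IH].
  by rewrite !comp_mpoly0.
rewrite !comp_mpolyD IH !comp_mpolyZ; congr (_ *: _ + _).
rewrite comp_mpolyX rmorph_prod /= [RHS]mpolyXE_id.
apply: eq_bigr => j _; rewrite rmorphXn /= tnth_mktuple; congr (_ ^+ _).
case: eqP => [->|ji]; rewrite ?comp_mpolyZ comp_mpolyXU -tnth_nth tnth_mktuple.
  by rewrite eqxx scalerA mulfV ?scale1r.
by case: eqP.
Qed.

Lemma qshift_mpoly_neq0 q i p : q != 0 -> p != 0 -> qshift_mpoly q i p != 0.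
Proof.
move=> q0; have s0 : qshift_mpoly q i 0 = 0 by exact: comp_mpoly0.
by rewrite -{2}s0 (inj_eq (qshift_mpoly_inj q0)).
Qed.

Lemma Gamma_div q i (n d : {mpoly K[N]}) : q != 0 -> d != 0 ->
  Gamma q i (n%:F / d%:F) = (qshift_mpoly q i n)%:F / (qshift_mpoly q i d)%:F.
Proof.
move=> q0 d0; rewrite /Gamma; set f : ratfun K N := n%:F / _.
have rd0 := denom_ratioP (repr f).
apply/eqP; rewrite eqr_div ?tofrac_eq0 ?qshift_mpoly_neq0 //.
rewrite -!tofracM -!rmorphM /= tofrac_eq; apply/eqP; congr comp_mpoly.
apply/eqP; rewrite -tofrac_eq !tofracM -eqr_div ?tofrac_eq0 //.
by rewrite -fraction_numden.
Qed.

Lemma Gamma_rvar q i j : q != 0 ->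
  Gamma q i (rvar j) = if j == i then rcst q * rvar j else rvar j.
Proof.
move=> q0; rewrite -[rvar j]divr1 -tofrac1 Gamma_div ?oner_neq0 //.
rewrite /qshift_mpoly comp_mpoly1 tofrac1 !divr1 comp_mpolyXU.
rewrite -tnth_nth tnth_mktuple; case: eqP => // _.
by rewrite -mul_mpolyC tofracM.
Qed.

End Operators.

Arguments rcst {K N} c.
Arguments rvar {K N} i.
Arguments Xop {K N} f.

Lemma qpar_neq0 (C : fieldType) : qpar C != 0.
Proof.
rewrite tofrac_eq0; apply/eqP => /(congr1 (mcoeff U_(ord0))).
by rewrite mcoeffX eqxx mcoeff0 => /eqP; rewrite oner_eq0.
Qed.

(* Main.v *)
Require Import Defs.
From HB Require Import structures.
From mathcomp Require Import all_boot all_order all_algebra.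
From mathcomp Require Import complex reals mpoly.

Import GRing.Theory.

Local Open Scope ring_scope.

(** The shift [Gamma q i] is the substitution [x_i := q x_i], hence a ring
endomorphism of the field of rational functions as soon as [q != 0]; so is the
composite [Gamma_set q I].  Two consequences give the two halves of the
theorem.

- Multiplicativity yields the formula for [R1].  Moving the multiplication by
  [p = \sum_i x_i] through [Gamma_set q I] turns it into multiplication by
  [Gamma_set q I p], and [Gamma_set q I p - p] is [(q - 1) \sum_(i in I) x_i],
  because only the variables indexed by [I] are rescaled
  ([Gamma_set_sum_rvar]).  Each term of the Macdonald operator therefore
  contributes its own coefficient times this difference.

- Additivity makes the Macdonald operator [M] additive, and the formula for
  [[M^k, X]] is the Leibniz rule for [[_, X]], valid for any additive [M]
  ([commutator_iter]). *)

Local Notation "x %:F" := (FracField.tofrac x).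

Section Shift.

Context {K : fieldType} {N : nat} {q : K}.
Hypothesis q_neq0 : q != 0.
Implicit Types (i j : 'I_N) (I : {set 'I_N}) (f g : ratfun K N).

Lemma ratfun_fracP f :
  exists n d : {mpoly K[N]}, d != 0 /\ f = n%:F / d%:F.
Proof.
exists \n_(repr f), \d_(repr f).
by split; [exact: denom_ratioP | exact: fraction_numden].
Qed.

Lemma GammaM i : {morph Gamma q i : f g / f * g}.
Proof.
move=> f g.
have [n [d [d0 ->]]] := ratfun_fracP f; have [m [e [e0 ->]]] := ratfun_fracP g.
rewrite mulf_div -!tofracM !Gamma_div ?mulf_neq0 //.
by rewrite mulf_div -!tofracM -!rmorphM.
Qed.

Lemma GammaB i : {morph Gamma q i : f g / f - g}.
Proof.
move=> f g.
have [n [d [d0 ->]]] := ratfun_fracP f; have [m [e [e0 ->]]] := ratfun_fracP g.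
have subf_div (u v w z : ratfun K N) : v != 0 -> z != 0 ->
    u / v - w / z = (u * z - w * v) / (v * z).
  by move=> v0 z0; rewrite -mulNr addf_div // mulNr.
rewrite subf_div ?tofrac_eq0 // -!tofracM -tofracB !Gamma_div ?mulf_neq0 //.
rewrite subf_div ?tofrac_eq0 ?qshift_mpoly_neq0 // -!tofracM -tofracB.
by rewrite /qshift_mpoly rmorphB !rmorphM.
Qed.

Lemma Gamma_rcst i c : Gamma q i (rcst c) = rcst c.
Proof.
rewrite -[rcst c]divr1 -tofrac1 Gamma_div ?oner_neq0 //.
by rewrite /qshift_mpoly comp_mpoly1 comp_mpolyC.
Qed.

Lemma Gamma_setM I : {morph Gamma_set q I : f g / f * g}.
Proof.
rewrite /Gamma_set; elim/big_ind: _ => //; last by move=> i _; exact: GammaM.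
by move=> A B AM BM f g /=; rewrite BM AM.
Qed.

Lemma Gamma_setB I : {morph Gamma_set q I : f g / f - g}.
Proof.
rewrite /Gamma_set; elim/big_ind: _ => //; last by move=> i _; exact: GammaB.
by move=> A B AB BB f g /=; rewrite BB AB.
Qed.

HB.instance Definition _ I :=
  GRing.isZmodMorphism.Build (ratfun K N) (ratfun K N) (Gamma_set q I)
    (Gamma_setB I).

Lemma Gamma_set_rvar I j :
  Gamma_set q I (rvar j) = if j \in I then rcst q * rvar j else rvar j.
Proof.
(* The composite is ordered by an enumeration of I, which has no repetition:
   x_j picks up the factor q exactly once. *)
rewrite /Gamma_set -big_filter.
have := filter_uniq (mem I) (index_enum_uniq 'I_N).
have -> : (j \in I) = (j \in [seq i <- index_enum 'I_N | i \in I]).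
  by rewrite mem_filter mem_index_enum andbT.
elim: (filter _ _) => [|i s IHs] /=; first by rewrite big_nil.
case/andP=> i_s /IHs{}IHs; rewrite big_cons /= IHs inE.
have [->|ji] /= := eqVneq j i.
  by rewrite (negPf i_s) Gamma_rvar // eqxx.
by case: ifP => _; rewrite ?GammaM ?Gamma_rcst Gamma_rvar // (negPf ji).
Qed.

Lemma Gamma_set_sum_rvar I :
  Gamma_set q I (\sum_(j < N) rvar j) - \sum_(j < N) rvar j
  = (rcst q - 1) * \sum_(i in I) rvar i.
Proof.
rewrite raddf_sum -sumrB mulr_sumr [RHS]big_mkcond; apply: eq_bigr => j _ /=.
by rewrite Gamma_set_rvar; case: ifP => _; rewrite ?subrr // mulrBl mul1r.
Qed.

Lemma macdonaldB (t : K) a : {morph macdonald (N := N) q t a : f g / f - g}.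
Proof.
move=> f g; rewrite /macdonald -sumrB; apply: eq_bigr => I _.
by rewrite Gamma_setB mulrBr.
Qed.

Lemma commutator_macdonald (t : K) a f :
  commutator (macdonald q t a) Xop f =
  (rcst q - 1) * \sum_(I : {set 'I_N} | #|I| == a)
     macdonald_coef t I * (\sum_(i in I) rvar i) * Gamma_set q I f.
Proof.
rewrite /commutator /macdonald [Xop (\sum_(I | _) _)]mulr_sumr -sumrB.
rewrite [RHS]mulr_sumr.
apply: eq_bigr => I _; rewrite /Xop Gamma_setM.
rewrite [X in _ - X]mulrCA -mulrBr -mulrBl Gamma_set_sum_rvar.
by rewrite !mulrA [_ * (rcst q - 1)]mulrC.
Qed.

End Shift.

(** Leibniz rule for [[_, X]]: splitting off the outer factor,
[[M^(k+1), X] = [M, X] M^k + M [M^k, X]], and additivity lets [M] enter the sum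
that expands [[M^k, X]]. *)
Lemma commutator_iter (K : fieldType) (N : nat)
    (M : {additive ratfun K N -> ratfun K N}) (X : ratfun K N -> ratfun K N)
    (k : nat) (f : ratfun K N) :
  commutator (iter k M) X f =
  \sum_(j < k) iter j M (commutator M X (iter (k - 1 - j) M f)).
Proof.
elim: k => [|k IHk]; first by rewrite big_ord0 /commutator /= subrr.
rewrite big_ord_recl /= !subn1 subn0 /=.
have -> : commutator (fun g => M (iter k M g)) X f =
    commutator M X (iter k M f) + M (commutator (iter k M) X f).
  by rewrite /commutator raddfB [RHS]addrC [RHS]addrA subrK.
rewrite IHk raddf_sum; congr (_ + _); apply: eq_bigr => j _ /=.
by rewrite -subnDA add1n.
Qed.

Theorem theorem4p1 (R : realType) (N a : nat) :
  (1 <= N)%N -> (1 <= a <= N)%N ->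
  let q := qpar R[i] in
  let t := tpar R[i] in
  let M := macdonald (N := N) q t a in
  let X := Xop (K := Cqt R[i]) (N := N) in
  let R1 := commutator M X in
  (forall k : nat,
     commutator (iter k M) X =1
       fun f => \sum_(j < k) iter j M (R1 (iter (k - 1 - j) M f)))
  /\
  (R1 =1 fun f =>
     (rcst q - 1) *
     \sum_(I : {set 'I_N} | #|I| == a)
        macdonald_coef t I * (\sum_(i in I) rvar i) * Gamma_set q I f).
Proof.
move=> _ _ q t M X R1; have q_neq0 : q != 0 := qpar_neq0 R[i].
split=> [k f|f]; last exact: commutator_macdonald.
pose addM := GRing.isZmodMorphism.Build _ _ M (macdonaldB q_neq0 t a).
pose M' : {additive ratfun (Cqt R[i]) N -> ratfun (Cqt R[i]) N} :=
  HB.pack M addM.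
exact: (commutator_iter _ _ M').
Qed.
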